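(* Let $n\geq 3$ and let $\mathcal{L}$ be a Lie algebra of type $M(n,{\bf a},{\bf c},{\bf d})$. Then there exists an ideal $I$ of $\mathrm{gim}(M_n)$ such that $\mathrm{gim}(M_n)/I\cong\mathcal{L}$.
   Context: All Lie algebras are over $\mathbb{C}$. For $n\geq 3$, $M_n=(m_{i,j})_{1\le i,j\le n}$ is the $n\times n$ integer matrix with $m_{i,i}=2$ for all $i$, $m_{i,i+1}=m_{i+1,i}=-1$ for $1\leq i\leq n-1$, $m_{1,n}=m_{n,1}=1$, and all other entries $0$. The Lie algebra $\mathrm{gim}(M_n)$ is the Lie algebra generated by $e_1,\dots,e_n,f_1,\dots,f_n,h_1,\dots,h_n$ subject to the relations: (R1) for all $1\le i,j\le n$: $[h_i,e_j]=m_{i,j}e_j$, $[h_i,f_j]=-m_{i,j}f_j$, $[e_i,f_i]=h_i$; (R2) for $i\neq j$ with $m_{i,j}\leq 0$: $[e_i,f_j]=0=[f_i,e_j]$ and $(\mathrm{ad}\,e_i)^{-m_{i,j}+1}e_j=0=(\mathrm{ad}\,f_i)^{-m_{i,j}+1}f_j$; (R3) for $i\neq j$ with $m_{i,j}>0$: $[e_i,e_j]=0=[f_i,f_j]$ and $(\mathrm{ad}\,e_i)^{m_{i,j}+1}f_j=0=(\mathrm{ad}\,f_i)^{m_{i,j}+1}e_j$. A Lie algebra $\mathcal{L}$ is said to be of type $M(n,{\bf a},{\bf c},{\bf d})$ (where $n\ge 3$, ${\bf a}\in\mathbb{Z}_{\geq 0}$, ${\bf c},{\bf d}\in\{0,1\}$)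 if $\mathcal{L}$ is a non-trivial (nonzero) semisimple Lie algebra isomorphic to a direct sum of ${\bf a}$ copies of $sl_{2n}$, ${\bf c}$ copies of $sp_{2n}$ and ${\bf d}$ copies of $so_{2n}$. *)

(* Defs.v *)
From HB Require Import structures.
From mathcomp Require Import all_boot all_algebra.
From mathcomp Require Import reals.
From mathcomp.real_closed Require Import complex.
Set Implicit Arguments. Unset Strict Implicit. Unset Printing Implicit Defensive.
Import GRing.Theory.
Local Open Scope ring_scope.

Record lie_algebra (K : fieldType) := LieAlgebra {
  lie_carrier :> lmodType K;
  lie_br : lie_carrier -> lie_carrier -> lie_carrier;
  lie_br_linl : forall (k : K) (x y z : lie_carrier),
      lie_br (k *: x + y) z = k *: lie_br x z + lie_br y z;
  lie_br_linr : forall (k : K) (x y z : lie_carrier),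
      lie_br z (k *: x + y) = k *: lie_br z x + lie_br z y;
  lie_br_alt : forall x : lie_carrier, lie_br x x = 0;
  lie_jacobi : forall x y z : lie_carrier,
      lie_br x (lie_br y z) + lie_br y (lie_br z x) + lie_br z (lie_br x y) = 0
}.

Definition lie_hom (K : fieldType) (L1 L2 : lie_algebra K) (phi : L1 -> L2) : Prop :=
  (forall (k : K) (x y : L1), phi (k *: x + y) = k *: phi x + phi y) /\
  (forall x y : L1, phi (lie_br x y) = lie_br (phi x) (phi y)).

Definition lie_ideal (K : fieldType) (L : lie_algebra K) (I : L -> Prop) : Prop :=
  I 0 /\
  (forall (k : K) (x y : L), I x -> I y -> I (k *: x + y)) /\
  (forall x y : L, I y -> I (lie_br x y)).

(* L / I is isomorphic to L' : by the first isomorphism theorem this means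
   there is a surjective Lie homomorphism L -> L' whose kernel is exactly I
   (it induces the isomorphism L/I ~ L'). *)
Definition lie_quotient_iso (K : fieldType) (L : lie_algebra K) (I : L -> Prop)
    (L' : lie_algebra K) : Prop :=
  exists phi : L -> L',
    [/\ lie_hom phi,
        (forall y : L', exists x : L, phi x = y) &
        (forall x : L, phi x = 0 <-> I x)].

Definition gimM (n : nat) (i j : 'I_n) : int :=
  if i == j then 2
  else if (i.+1 == j :> nat) || (j.+1 == i :> nat) then -1
  else if ((i == 0 :> nat) && (j == n.-1 :> nat)) ||
          ((j == 0 :> nat) && (i == n.-1 :> nat)) then 1
  else 0.

Definition gim_relations (K : fieldType) (n : nat) (L : lie_algebra K)
    (e f h : 'I_n -> L) : Prop :=
  (forall i j : 'I_n,
      [/\ lie_br (h i) (e j) = (gimM i j)%:~R *: e j,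
          lie_br (h i) (f j) = - ((gimM i j)%:~R *: f j) &
          lie_br (e i) (f i) = h i]) /\
  (forall i j : 'I_n, i != j -> (gimM i j <= 0)%R ->
      [/\ lie_br (e i) (f j) = 0, lie_br (f i) (e j) = 0,
          iter (absz (1 - gimM i j)) (lie_br (e i)) (e j) = 0 &
          iter (absz (1 - gimM i j)) (lie_br (f i)) (f j) = 0]) /\
  (forall i j : 'I_n, i != j -> (0 < gimM i j)%R ->
      [/\ lie_br (e i) (e j) = 0, lie_br (f i) (f j) = 0,
          iter (absz (gimM i j + 1)) (lie_br (e i)) (f j) = 0 &
          iter (absz (gimM i j + 1)) (lie_br (f i)) (e j) = 0]).

(* G together with e f h is (a model of) gim(M_n): the Lie algebra presented by
   generators e_i, f_i, h_i and relations (R1)-(R3), characterised by its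
   universal property (it is unique up to unique isomorphism). *)
Definition is_gim (K : fieldType) (n : nat) (G : lie_algebra K)
    (e f h : 'I_n -> G) : Prop :=
  gim_relations e f h /\
  forall (L : lie_algebra K) (e' f' h' : 'I_n -> L),
    gim_relations e' f' h' ->
    (exists phi : G -> L,
        lie_hom phi /\ forall i, [/\ phi (e i) = e' i, phi (f i) = f' i & phi (h i) = h' i]) /\
    (forall phi1 phi2 : G -> L,
        lie_hom phi1 -> lie_hom phi2 ->
        (forall i, [/\ phi1 (e i) = e' i, phi1 (f i) = f' i & phi1 (h i) = h' i]) ->
        (forall i, [/\ phi2 (e i) = e' i, phi2 (f i) = f' i & phi2 (h i) = h' i]) ->
        forall x, phi1 x = phi2 x).

Definition mx_comm (K : fieldType) (m : nat) (A B : 'M[K]_m) : 'M[K]_m :=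
  A *m B - B *m A.

Definition is_sl (K : fieldType) (m : nat) (A : 'M[K]_m) : Prop := \tr A = 0.

(* standard symplectic form J = [[0, I_n], [-I_n, 0]] *)
Definition sympJ (K : fieldType) (n : nat) : 'M[K]_(2 * n) :=
  \matrix_(i, j)
    (if ((i : nat) < n)%N && ((j : nat) == (i : nat) + n)%N then 1
     else if ((j : nat) < n)%N && ((i : nat) == (j : nat) + n)%N then -1 else 0).

Definition is_sp (K : fieldType) (n : nat) (A : 'M[K]_(2 * n)) : Prop :=
  A^T *m sympJ K n + sympJ K n *m A = 0.

Definition is_so (K : fieldType) (m : nat) (A : 'M[K]_m) : Prop := A^T = - A.

(* L is isomorphic to  sl_{2n}^{a} (+) sp_{2n}^{c} (+) so_{2n}^{d}  (the latter
   realised inside  'M_{2n}^a x 'M_{2n} x 'M_{2n}  with componentwise commutator,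
   the sp- (resp. so-) component being forced to 0 when c (resp. d) is false). *)
Definition lie_iso_sum (K : fieldType) (n a : nat) (c d : bool) (L : lie_algebra K) : Prop :=
  exists (psiA : 'I_a -> L -> 'M[K]_(2 * n)) (psiC psiD : L -> 'M[K]_(2 * n)),
    [/\
        (forall (k : K) (x y : L),
            [/\ forall t, psiA t (k *: x + y) = k *: psiA t x + psiA t y,
                psiC (k *: x + y) = k *: psiC x + psiC y &
                psiD (k *: x + y) = k *: psiD x + psiD y]),
        (forall x y : L,
            [/\ forall t, psiA t (lie_br x y) = mx_comm (psiA t x) (psiA t y),
                psiC (lie_br x y) = mx_comm (psiC x) (psiC y) &
                psiD (lie_br x y) = mx_comm (psiD x) (psiD y)]),
        (forall x y : L, (forall t, psiA t x = psiA t y) -> psiC x = psiC y ->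
                         psiD x = psiD y -> x = y),
        (forall x : L,
            [/\ forall t, is_sl (psiA t x),
                (if c then is_sp (psiC x) else psiC x = 0) &
                (if d then is_so (psiD x) else psiD x = 0)]) &
        (forall (A : 'I_a -> 'M[K]_(2 * n)) (B D : 'M[K]_(2 * n)),
            (forall t, is_sl (A t)) ->
            (if c then is_sp B else B = 0) ->
            (if d then is_so D else D = 0) ->
            exists x : L, [/\ forall t, psiA t x = A t, psiC x = B & psiD x = D])].

Definition lie_type_M (K : fieldType) (n a : nat) (c d : bool) (L : lie_algebra K) : Prop :=
  (0 < a + c + d)%N /\ lie_iso_sum n a c d L.

(* Main.v *)
Require Import Defs.
From mathcomp Require Import all_boot all_order all_algebra.
From mathcomp Require Import boolp reals zify ring.
From mathcomp.real_closed Require Import complex.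
Import GRing.Theory.
Local Open Scope ring_scope.

Set Implicit Arguments. Unset Strict Implicit. Unset Printing Implicit Defensive.

(* The image of a Lie homomorphism from gim(M_n) is the subalgebra generated by
   the images of the generators, so it suffices to find a generating family of
   the direct sum satisfying the relations; the ideal is then the kernel.
   For a parameter q != 0 let, in 2n x 2n matrices written in n x n blocks,
     e_i = diag(E_(i,i+1), - E_(i+1,i)) for i < n,
     e_n = the upper right block E_(1,n) + q E_(n,1),
   and f_i = e_i(1/q)^T.  These satisfy the relations for every q, and they lie
   in sp for q = 1, in the split so for q = -1, and in sl otherwise.  Give the
   factors distinct parameters q_t with q_s q_t != 1 for s != t.  The pairs of
   functions (l, m) of t such that all diag(l E_(i,j), - m E_(j,i)), i != j, are
   generated form a unital algebra containing (1/q, q).  Evaluating polynomials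
   at the separated points q_t, 1/q_t yields the indicator functions, which
   splits the problem into single factors. *)

(** * Commutators and Lie homomorphisms *)

Section Commutator.
Variables (K : fieldType) (m : nat).
Implicit Types A B C : 'M[K]_m.

Lemma mx_comm_linl (k : K) A B C :
  mx_comm (k *: A + B) C = k *: mx_comm A C + mx_comm B C.
Proof.
by rewrite /mx_comm mulmxDl mulmxDr scalerBr -scalemxAl -scalemxAr opprD addrACA.
Qed.

Lemma mx_comm_linr (k : K) A B C :
  mx_comm C (k *: A + B) = k *: mx_comm C A + mx_comm C B.
Proof.
by rewrite /mx_comm mulmxDl mulmxDr scalerBr -scalemxAl -scalemxAr opprD addrACA.
Qed.

Lemma mx_comm_alt A : mx_comm A A = 0.
Proof. exact: subrr. Qed.

Lemma mx_commC A B : mx_comm A B = - mx_comm B A.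
Proof. by rewrite /mx_comm opprB. Qed.

Lemma mx_comm_jacobi A B C :
  mx_comm A (mx_comm B C) + mx_comm B (mx_comm C A) + mx_comm C (mx_comm A B) = 0.
Proof.
rewrite /mx_comm !mulmxBl !mulmxBr !mulmxA.
by apply/matrixP => i j; rewrite !mxE; ring.
Qed.

Lemma trmx_comm A B : (mx_comm A B)^T = - mx_comm A^T B^T.
Proof. by rewrite /mx_comm linearB /= !trmx_mul opprB. Qed.

Lemma mx_comm0l A : mx_comm 0 A = 0.
Proof. by rewrite /mx_comm mulmx0 mul0mx subrr. Qed.

(** Expanding gives $[A,[A,B]] = A^2B - 2ABA + BA^2$. The Serre relations of exponent 2 thus reduce
    to the vanishing of squares and of sandwich products. *)
Lemma mx_comm_sandwich A B :
  A *m A = 0 -> A *m B *m A = 0 -> mx_comm A (mx_comm A B) = 0.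
Proof.
move=> AA ABA; rewrite /mx_comm mulmxBr mulmxBl !mulmxA AA ABA mul0mx.
by rewrite -(mulmxA B) AA mulmx0 !subr0.
Qed.

Definition gl_lie : lie_algebra K :=
  @LieAlgebra K 'M[K]_m (@mx_comm K m) mx_comm_linl mx_comm_linr mx_comm_alt
    mx_comm_jacobi.

End Commutator.

Section LieHom.
Variables (K : fieldType) (L1 L2 : lie_algebra K) (phi : L1 -> L2).
Hypothesis phi_hom : lie_hom phi.

Lemma lie_hom_lin k x y : phi (k *: x + y) = k *: phi x + phi y.
Proof. by case: phi_hom. Qed.

Lemma lie_hom_br x y : phi (lie_br x y) = lie_br (phi x) (phi y).
Proof. by case: phi_hom. Qed.

Lemma lie_hom0 : phi 0 = 0.
Proof.
have := lie_hom_lin (-1) 0 0.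
by rewrite scaler0 addr0 scaleN1r addNr.
Qed.

Lemma lie_homZ k x : phi (k *: x) = k *: phi x.
Proof. by have := lie_hom_lin k x 0; rewrite lie_hom0 !addr0. Qed.

Lemma lie_homN x : phi (- x) = - phi x.
Proof. by rewrite -scaleN1r lie_homZ scaleN1r. Qed.

Lemma lie_hom_iter k x y :
  phi (iter k (lie_br x) y) = iter k (lie_br (phi x)) (phi y).
Proof. by elim: k => //= k IH; rewrite lie_hom_br IH. Qed.

End LieHom.

(** Each relation is an equation between Lie expressions, so a jointly injective family of
    homomorphisms reflects it. This allows the relations of a direct sum to be checked one factor at
    a time. *)
Lemma gim_relations_pullback (K : fieldType) (n : nat) (L : lie_algebra K)
    (T : Type) (M : T -> lie_algebra K) (psi : forall t, L -> M t)
    (e f h : 'I_n -> L) :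
  (forall t, lie_hom (psi t)) ->
  (forall x y, (forall t, psi t x = psi t y) -> x = y) ->
  (forall t, gim_relations (psi t \o e) (psi t \o f) (psi t \o h)) ->
  gim_relations e f h.
Proof.
move=> hom inj rel.
have psi0 t : psi t 0 = 0 := lie_hom0 (hom t).
split; [|split].
- move=> i j; split; apply: inj => t; case: (rel t) => /(_ i j)[/= r1 r2 r3] _.
  + by rewrite (lie_hom_br (hom t)) (lie_homZ (hom t)).
  + by rewrite (lie_hom_br (hom t)) (lie_homN (hom t)) (lie_homZ (hom t)).
  + by rewrite (lie_hom_br (hom t)).
- move=> i j ij mij; split; apply: inj => t;
    case: (rel t) => _ [/(_ i j ij mij)[/= r1 r2 r3 r4] _];
    by rewrite psi0 ?(lie_hom_iter (hom t)) ?(lie_hom_br (hom t)).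
- move=> i j ij mij; split; apply: inj => t;
    case: (rel t) => _ [_ /(_ i j ij mij)[/= r1 r2 r3 r4]];
    by rewrite psi0 ?(lie_hom_iter (hom t)) ?(lie_hom_br (hom t)).
Qed.

Ltac delta_neq := repeat match goal with
  | H : is_true (?x != ?y) |- _ =>
     rewrite ?(negPf H) ?[y == x]eq_sym ?(negPf H); clear H end;
  rewrite ?mulr0n ?mulr1n ?scaler0 ?addr0 ?add0r ?subr0 ?sub0r ?oppr0.

Ltac mxring := apply/matrixP => ? ?; rewrite !mxE; ring.

(** * Block matrices *)

Section Blocks.
Variables (K : fieldType) (n : nat).
Implicit Types (X Y b c : 'M[K]_n) (q : K).

Definition dg X Y : 'M[K]_(n + n) := block_mx X 0 0 Y.
Definition ur b : 'M[K]_(n + n) := block_mx 0 b 0 0.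
Definition ll c : 'M[K]_(n + n) := block_mx 0 0 c 0.

Definition block_simp := (mulmx_block, add_block_mx, opp_block_mx,
  mulmx0, mul0mx, addr0, add0r, oppr0).

Lemma comm_dd X Y X' Y' :
  mx_comm (dg X Y) (dg X' Y') = dg (mx_comm X X') (mx_comm Y Y').
Proof. by rewrite /mx_comm /dg !block_simp. Qed.

Lemma comm_du X Y b : mx_comm (dg X Y) (ur b) = ur (X *m b - b *m Y).
Proof. by rewrite /mx_comm /dg /ur !block_simp. Qed.

Lemma comm_dl X Y c : mx_comm (dg X Y) (ll c) = ll (Y *m c - c *m X).
Proof. by rewrite /mx_comm /dg /ll !block_simp. Qed.

Lemma comm_ul b c : mx_comm (ur b) (ll c) = dg (b *m c) (- (c *m b)).
Proof. by rewrite /mx_comm /dg /ur /ll !block_simp. Qed.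

Lemma dg_lin k X Y X' Y' : k *: dg X Y + dg X' Y' = dg (k *: X + X') (k *: Y + Y').
Proof. by rewrite /dg scale_block_mx add_block_mx !scaler0 !addr0. Qed.

Lemma ur_lin k b b' : k *: ur b + ur b' = ur (k *: b + b').
Proof. by rewrite /ur scale_block_mx add_block_mx !scaler0 !addr0. Qed.

Lemma ll_lin k b b' : k *: ll b + ll b' = ll (k *: b + b').
Proof. by rewrite /ll scale_block_mx add_block_mx !scaler0 !addr0. Qed.

Lemma dg0 : dg 0 0 = 0. Proof. exact: block_mx0. Qed.
Lemma ur0 : ur 0 = 0. Proof. exact: block_mx0. Qed.
Lemma ll0 : ll 0 = 0. Proof. exact: block_mx0. Qed.

Lemma dgZ k X Y : k *: dg X Y = dg (k *: X) (k *: Y).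
Proof. by rewrite -[LHS]addr0 -dg0 dg_lin !addr0. Qed.

Lemma urZ k b : k *: ur b = ur (k *: b).
Proof. by rewrite -[LHS]addr0 -ur0 ur_lin addr0. Qed.

Lemma llZ k c : k *: ll c = ll (k *: c).
Proof. by rewrite -[LHS]addr0 -ll0 ll_lin addr0. Qed.

Lemma dgD X Y X' Y' : dg X Y + dg X' Y' = dg (X + X') (Y + Y').
Proof. by rewrite -[X in X + _]scale1r dg_lin !scale1r. Qed.

Lemma tr_dg X Y : (dg X Y)^T = dg X^T Y^T.
Proof. by rewrite /dg tr_block_mx !trmx0. Qed.

Lemma tr_ur b : (ur b)^T = ll b^T.
Proof. by rewrite /ur tr_block_mx !trmx0. Qed.

Lemma block_dul X b c Y : block_mx X b c Y = dg X Y + (ur b + ll c).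
Proof. by rewrite /dg /ur /ll !add_block_mx !addr0 !add0r. Qed.

(** For $l = m = 1$ this is the image of $E_{ij}$ under the embedding $X \mapsto \mathrm{diag}(X,
    -X^T)$ of $gl_n$. Two separate scalars make it possible to tell the diagonal blocks apart. *)
Definition dE (l m : K) (i j : 'I_n) :=
  dg (l *: delta_mx i j) (- (m *: delta_mx j i)).
Definition uE q (i j : 'I_n) := ur (delta_mx i j + q *: delta_mx j i).
Definition lE q (i j : 'I_n) := ll (delta_mx i j + q^-1 *: delta_mx j i).

Lemma tr_uE q i j : (uE q i j)^T = lE q^-1 j i.
Proof. by rewrite tr_ur linearD /= linearZ /= !trmx_delta /lE invrK. Qed.

Lemma tr_dE l m i j : (dE l m i j)^T = dE l m j i.
Proof. by rewrite tr_dg [(- _)^T]linearN /= ![(_ *: _)^T]linearZ /= !trmx_delta. Qed.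

Definition delta_simp := (mulmxDl, mulmxDr, mulNmx, mulmxN, =^~ scalemxAl,
  =^~ scalemxAr, mul_delta_mx_cond, eqxx, mulr1n).

(** Composition through the middle index $k$ multiplies the pairs $(l, m)$ and $(l', m')$
    componentwise. *)
Lemma comm_dEdE l m l' m' i k j : i != j ->
  mx_comm (dE l m i k) (dE l' m' k j) = dE (l * l') (m * m') i j.
Proof.
move=> ij; rewrite /dE comm_dd /mx_comm !delta_simp; delta_neq.
by congr dg; mxring.
Qed.

Lemma comm_dEuE q i j k : i != j -> mx_comm (dE 1 1 k i) (uE q i j) = uE q k j.
Proof.
move=> ij; rewrite /dE comm_du !delta_simp; delta_neq.
by congr ur; mxring.
Qed.

Lemma comm_dEuE' q i j k : i != j -> mx_comm (dE 1 1 k j) (uE q i j) = uE q i k.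
Proof.
move=> ij; rewrite /dE comm_du !delta_simp; delta_neq.
by congr ur; mxring.
Qed.

Lemma comm_dElE q i j k : i != j ->
  mx_comm (dE 1 1 i k) (lE q i j) = (-1) *: lE q k j.
Proof.
move=> ij; rewrite /dE comm_dl !delta_simp; delta_neq.
by rewrite llZ; congr ll; mxring.
Qed.

Lemma comm_dElE' q i j k : i != j ->
  mx_comm (dE 1 1 j k) (lE q i j) = (-1) *: lE q i k.
Proof.
move=> ij; rewrite /dE comm_dl !delta_simp; delta_neq.
by rewrite llZ; congr ll; mxring.
Qed.

(** The source of the pair $(1/q, q)$, through which the parameter becomes visible in the diagonal
    blocks. *)
Lemma comm_uElE q i j k : i != j -> i != k -> k != j ->
  mx_comm (uE q i j) (lE q k j) = dE q^-1 q i k.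
Proof.
move=> ij ik kj; rewrite /uE comm_ul !delta_simp; delta_neq.
by congr dg; mxring.
Qed.

Lemma comm_uElE_diag q i k : q != 0 -> i != k ->
  let D := delta_mx i i + delta_mx k k in
  mx_comm (uE q i k) (lE q k i) = dg D (- D).
Proof.
move=> q0 ik; rewrite /uE comm_ul; have qV := mulfV q0; have Vq := mulVf q0.
rewrite !delta_simp; delta_neq; rewrite !scalerA qV Vq !scale1r.
by congr dg; mxring.
Qed.

Lemma comm_dEdE_diag i k : i != k ->
  let D := delta_mx i i - delta_mx k k in
  mx_comm (dE 1 1 i k) (dE 1 1 k i) = dg D (- D).
Proof.
move=> ik; rewrite /dE comm_dd /mx_comm !delta_simp; delta_neq.
by congr dg; mxring.
Qed.

(** With the lower scalar zero, the bracket keeps a single matrix unit of the symmetrised pair in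
    [uE]. *)
Lemma comm_dEuE1 q i j k : k != j ->
  mx_comm (dE 1 0 i k) (uE q k j) = ur (delta_mx i j).
Proof.
move=> kj; rewrite /dE comm_du !delta_simp; delta_neq.
by congr ur; mxring.
Qed.

Lemma comm_dElE1 q i j k : k != j ->
  mx_comm (dE 0 1 k i) (lE q k j) = (-1) *: ll (delta_mx i j).
Proof.
move=> kj; rewrite /dE comm_dl !delta_simp; delta_neq.
by rewrite llZ; congr ll; mxring.
Qed.

End Blocks.

(** * The relations *)

Section Generators.
Variables (K : fieldType) (n : nat).
Hypothesis n_ge2 : (2 <= n)%N.
Implicit Types (q : K) (i j : 'I_n.+1).

Definition nx i : 'I_n.+1 := inord i.+1.

Lemma val_nx i : i != ord_max -> nx i = i.+1 :> nat.
Proof.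
move=> im; rewrite /nx inordK //; move: im (ltn_ord i); rewrite -val_eqE /=; lia.
Qed.

Lemma nx_neq i : i != ord_max -> i != nx i.
Proof. by move=> im; rewrite -val_eqE /= val_nx //; lia. Qed.

Lemma ord0_neq_max : (ord0 : 'I_n.+1) != ord_max.
Proof. by rewrite -val_eqE /=; lia. Qed.

Definition gE q i :=
  if i == ord_max then uE q ord0 ord_max else dE (1 : K) 1 i (nx i).
Definition gF q i :=
  if i == ord_max then lE q ord_max ord0 else dE (1 : K) 1 (nx i) i.

(* Coordinates of the simple root [alpha_i] in the weights [eps_k]:
   [eps_i - eps_(i+1)], and [eps_0 + eps_max] for the last one. *)
Definition wt i (k : 'I_n.+1) : int :=
  if i == ord_max then (k == ord0)%:Z + (k == ord_max)%:Z
  else (k == i)%:Z - (k == nx i)%:Z.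

Definition wtmx i : 'M[K]_n.+1 := diag_mx (\row_k (wt i k)%:~R).
Definition gH i := dg (wtmx i) (- wtmx i).

(** Transposition exchanges $e_i$ and $f_i$ and inverts $q$, so facts about [gF] follow from those
    about [gE] at the inverse parameter. *)
Lemma tr_gE q i : (gE q i)^T = gF q^-1 i.
Proof. by rewrite /gE /gF; case: eqP => _; rewrite ?tr_uE ?tr_dE. Qed.

Lemma tr_gF q i : (gF q i)^T = gE q^-1 i.
Proof. by apply: trmx_inj; rewrite trmxK tr_gE invrK. Qed.

(** A case view that replaces the matrix entry by a numeral, so that the iteration counts in the
    Serre relations compute. *)
Variant gimM_spec i j : int -> Prop :=
| GimMDiag of i = j : gimM_spec i j 2
| GimMAdj of i != j & i.+1 = j :> nat : gimM_spec i j (-1)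
| GimMAdj' of i != j & j.+1 = i :> nat : gimM_spec i j (-1)
| GimMEnds of i = ord0 & j = ord_max : gimM_spec i j 1
| GimMEnds' of i = ord_max & j = ord0 : gimM_spec i j 1
| GimMFar of i != j & i.+1 != j :> nat & j.+1 != i :> nat
    & ~~ ((i == ord0) && (j == ord_max)) & ~~ ((i == ord_max) && (j == ord0))
  : gimM_spec i j 0.

Lemma gimMP i j : gimM_spec i j (gimM i j).
Proof.
rewrite /gimM; case: (eqVneq i j) => [|ij]; first exact: GimMDiag.
case: eqP => /= [|/eqP ij1]; first exact: GimMAdj.
case: eqP => /= [|/eqP ji1]; first exact: GimMAdj'.
case: (boolP ((i == 0 :> nat) && _)) => /= [/andP[/eqP i0 /eqP jm]|n1].
  by apply: GimMEnds; exact: val_inj.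
case: (boolP ((j == 0 :> nat) && _)) => /= [/andP[/eqP j0 /eqP im]|n2].
  by apply: GimMEnds'; exact: val_inj.
by apply: GimMFar => //; rewrite -!val_eqE //= andbC.
Qed.

Lemma gimMC i j : gimM i j = gimM j i.
Proof.
rewrite /gimM eq_sym orbC; case: eqP => // _; case: ifP => // _.
by rewrite orbC.
Qed.

(** $M_n$ is the Gram matrix of the roots $\alpha_i$: the right-hand side is the scalar product of
    $\alpha_i$ and $\alpha_j$ in the coordinates [wt]. *)
Lemma wt_gimM i j :
  gimM i j = if j == ord_max then wt i ord0 + wt i ord_max else wt i j - wt i (nx j).
Proof.
rewrite /gimM /wt -!val_eqE /=.
have nxE (k : 'I_n.+1) : (k : nat) != n -> nx k = k.+1 :> nat.
  by move=> km; apply: val_nx; rewrite -val_eqE.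
move: (ltn_ord i) (ltn_ord j) (nxE i) (nxE j).
case: (eqVneq (i : nat) n) => im; case: (eqVneq (j : nat) n) => jm ni nj.
all: rewrite -?val_eqE ?eqxx /= ?im ?jm => Hi Hj.
all: rewrite ?(Hi isT) ?(Hj isT).
all: repeat case: eqP => ? /=; try done; exfalso; lia.
Qed.

Lemma diag_mul_delta (d : 'rV[K]_n.+1) k l :
  diag_mx d *m delta_mx k l = d 0 k *: delta_mx k l :> 'M_n.+1.
Proof.
rewrite mul_diag_mx; apply/matrixP => x y; rewrite !mxE.
by case: (eqVneq x k) => [->|_] //=; rewrite !mulr0.
Qed.

Lemma delta_mul_diag (d : 'rV[K]_n.+1) k l :
  delta_mx k l *m diag_mx d = d 0 l *: delta_mx k l :> 'M_n.+1.
Proof.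
apply: trmx_inj; rewrite trmx_mul linearZ /= trmx_delta tr_diag_mx.
exact: diag_mul_delta.
Qed.

Lemma comm_gH_gE q i j : mx_comm (gH i) (gE q j) = (gimM i j)%:~R *: gE q j.
Proof.
rewrite wt_gimM /gH /gE /wtmx; case: (j == ord_max).
  rewrite comm_du urZ rmorphD /=; congr ur.
  rewrite mulmxN mulmxDl mulmxDr -scalemxAl -scalemxAr !diag_mul_delta.
  rewrite !delta_mul_diag !mxE.
  by mxring.
rewrite comm_dd dgZ /mx_comm rmorphB /=.
rewrite !scale1r mulNmx mulmxN mulmxN mulNmx !diag_mul_delta !delta_mul_diag !mxE.
by congr dg; mxring.
Qed.

Lemma tr_gH i : (gH i)^T = gH i.
Proof. by rewrite tr_dg [(- _)^T]linearN /= tr_diag_mx. Qed.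

Lemma comm_gH_gF q i j : mx_comm (gH i) (gF q j) = - ((gimM i j)%:~R *: gF q j).
Proof.
apply: trmx_inj; rewrite trmx_comm tr_gH tr_gF comm_gH_gE.
by rewrite [(- _)^T]linearN /= [(_ *: _)^T]linearZ /= tr_gF.
Qed.

Lemma delta_diagE (k : 'I_n.+1) :
  delta_mx k k = diag_mx (\row_l (l == k)%:R) :> 'M[K]_n.+1.
Proof.
apply/matrixP => x y; rewrite !mxE; case: (eqVneq x y) => [->|xy].
  by rewrite andbb mulr1n.
by case: eqP => [<-|//]; rewrite eq_sym (negPf xy).
Qed.

Lemma wtmxE i : wtmx i =
  if i == ord_max then delta_mx ord0 ord0 + delta_mx ord_max ord_max
  else delta_mx i i - delta_mx (nx i) (nx i).
Proof.
rewrite /wtmx /wt !delta_diagE; case: (i == ord_max); apply/matrixP => x y;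
  by rewrite !mxE ?rmorphD ?rmorphN /= ?mulrnDl ?mulNrn -!pmulrn.
Qed.

Lemma comm_gE_gF q i : q != 0 -> mx_comm (gE q i) (gF q i) = gH i.
Proof.
move=> q0; rewrite /gE /gF /gH wtmxE; case: (eqVneq i ord_max) => im.
  rewrite comm_ul !delta_simp (eq_sym ord_max) (negPf ord0_neq_max).
  rewrite !mulr0n !scaler0 !addr0 ?add0r !scalerA mulfV // mulVf // !scale1r.
  by congr dg; mxring.
by rewrite comm_dd /mx_comm !delta_simp; congr dg; mxring.
Qed.

(** * Squares and sandwich products of the generators *)

Lemma mx_square_dE q i j : i != j -> dE (1 : K) 1 i j *m dE 1 1 i j = 0 :> 'M_(n.+1 + n.+1).
Proof.
move=> ij; rewrite /dE /dg !block_simp !delta_simp eq_sym (negPf ij) !mulr0n.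
by rewrite ?scaler0 !oppr0 block_mx0.
Qed.

Lemma gE_square q i : gE q i *m gE q i = 0.
Proof.
rewrite /gE; case: (eqVneq i ord_max) => im; last exact: mx_square_dE (nx_neq im).
by rewrite /uE /ur !block_simp block_mx0.
Qed.

(** The product equals $b_{l,k'} E_{k,l'}$. *)
Lemma delta_sandwich (b : 'M[K]_n.+1) (k l k' l' : 'I_n.+1) :
  b l k' = 0 -> delta_mx k l *m b *m delta_mx k' l' = 0 :> 'M_n.+1.
Proof.
move=> b0; apply/matrixP => x y; rewrite !mxE big1 // => z _; rewrite !mxE.
case: (eqVneq z k') => [->|]; last by rewrite mulr0.
rewrite big1 ?mul0r // => w _; rewrite !mxE.
by case: (eqVneq w l) => [->|_]; rewrite ?b0 ?mulr0 ?andbF ?mul0r.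
Qed.

Lemma gE_sandwichE q i j : i != j -> gE q i *m gE q j *m gE q i = 0.
Proof.
rewrite /gE; case: (eqVneq i ord_max) => [->|im]; case: (eqVneq j ord_max) => jm /=.
- by [].
- by move=> _; rewrite /uE /dE /ur /dg !block_simp block_mx0.
- move=> _; rewrite /uE /dE /ur /dg !block_simp !scale1r mulmxN.
  have /negPf nx0 : nx i != ord0 by rewrite -val_eqE /= val_nx.
  by rewrite delta_sandwich ?oppr0 ?block_mx0 // !mxE nx0 andbF mulr0 addr0.
- move=> ij; rewrite /dE /dg !block_simp !scale1r !mulNmx !mulmxN !mulNmx.
  rewrite !delta_sandwich ?oppr0 ?block_mx0 // !mxE -!val_eqE /= !val_nx //;
  case: eqP => //= ?; case: eqP => //= ?; lia.
Qed.

Lemma gF_square q i : gF q i *m gF q i = 0.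
Proof. by apply: trmx_inj; rewrite trmx_mul tr_gF gE_square trmx0. Qed.

Lemma gF_sandwichF q i j : i != j -> gF q i *m gF q j *m gF q i = 0.
Proof.
move=> ij; apply: trmx_inj; rewrite [RHS]trmx0 !trmx_mul !tr_gF mulmxA.
exact: gE_sandwichE.
Qed.

Lemma gE_sandwichF q i j : i != j -> gE q i *m gF q j *m gE q i = 0.
Proof.
rewrite /gE /gF; case: (eqVneq i ord_max) => [->|im]; case: (eqVneq j ord_max) => jm /=.
- by [].
- by move=> _; rewrite /uE /dE /ur /dg !block_simp block_mx0.
- move=> _; rewrite /lE /dE /ll /dg !block_simp !scale1r !mulNmx.
  have /negPf i1 := im.
  by rewrite delta_sandwich ?oppr0 ?block_mx0 // !mxE i1 andbF mulr0 addr0.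
- move=> ij; rewrite /dE /dg !block_simp !scale1r !mulNmx !mulmxN !mulNmx.
  by rewrite !delta_sandwich ?oppr0 ?block_mx0 // !mxE;
    rewrite ?(negPf ij) ?[j == i]eq_sym ?(negPf ij) ?andbF.
Qed.

Lemma gF_sandwichE q i j : i != j -> gF q i *m gE q j *m gF q i = 0.
Proof.
have tr_sandwich (A B A' B' : 'M[K]_(n.+1 + n.+1)) :
    A^T = A' -> B^T = B' -> A' *m B' *m A' = 0 -> A *m B *m A = 0.
  move=> <- <- ABA; apply: trmx_inj.
  by rewrite !trmx_mul mulmxA ABA trmx0.
by move=> ij; exact: tr_sandwich (tr_gF q i) (tr_gE q j) (gE_sandwichF _ ij).
Qed.

(** * Commuting generators and the full set of relations *)

Lemma gimM_ge0 i j : i != j -> 0 <= gimM i j ->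
  ((i.+1 != j :> nat) * (j.+1 != i :> nat))%type.
Proof.
rewrite /gimM => /negPf ->; case: (boolP (_ || _)) => //.
by rewrite negb_or => /andP[].
Qed.

Lemma gimM_le0 i j : i != j -> gimM i j <= 0 ->
  ~~ ((i == ord0) && (j == ord_max)) && ~~ ((j == ord0) && (i == ord_max)).
Proof.
rewrite /gimM -negb_or -!val_eqE /= => /negPf ->.
case: (boolP (_ || (_.+1 == _ :> nat))) => [h _|_]; last by case: (_ || _).
by apply/negP => h'; move: h h'; lia.
Qed.

Lemma comm_gE_gE q i j : i != j -> 0 <= gimM i j -> mx_comm (gE q i) (gE q j) = 0.
Proof.
(* Since $i \neq j$, at most one of the two is the last node, and antisymmetry allows it to be
   $i$. *)
wlog jm : i j / j != ord_max.
  move=> H ij mij; case: (eqVneq j ord_max) => [jm|]; last by move=> /H; apply.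
  by rewrite mx_commC H ?oppr0 // ?(eq_sym j) ?(gimMC j) // -jm.
move=> ij /(gimM_ge0 ij)[/negPf ij1 /negPf ji1].
have nj0 : (ord0 == nx j) = false by rewrite -val_eqE /= val_nx.
have eq_nx k l : l != ord_max -> (k == nx l) = (l.+1 == k :> nat).
  by move=> lm; rewrite -val_eqE /= val_nx // eq_sym.
rewrite /gE (negPf jm); case: (eqVneq i ord_max) => [im|im].
  have /negPf mj : ord_max != nx j by rewrite -im eq_nx // ji1.
  rewrite mx_commC comm_du !delta_simp !(eq_sym (nx j)) nj0 mj.
  by rewrite !mulr0n !(scaler0, oppr0, addr0) ur0 oppr0.
rewrite comm_dd /mx_comm !delta_simp !(eq_sym (nx _)) !eq_nx // ij1 ji1.
by rewrite !mulr0n !(scaler0, oppr0, addr0) dg0.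
Qed.

Lemma comm_gE_gF0 q i j : i != j -> gimM i j <= 0 -> mx_comm (gE q i) (gF q j) = 0.
Proof.
move=> ij /(gimM_le0 ij)/andP[n1 n2].
have nx_inj : i != ord_max -> j != ord_max -> (nx i == nx j) = false.
  by move=> im jm; apply/negP => /eqP/(congr1 val)/=; rewrite !val_nx //;
    move: ij; rewrite -val_eqE /=; lia.
have nx0 k : k != ord_max -> (nx k == ord0) = false.
  by move=> km; rewrite -val_eqE /= val_nx.
rewrite /gE /gF; case: (eqVneq i ord_max) ij n1 n2 => [->|im].
  rewrite eq_sym andbT => jm _ j0; rewrite (negPf jm).
  rewrite mx_commC comm_du !delta_simp.
  rewrite !(eq_sym ord0) !(eq_sym ord_max) (negPf j0) (negPf jm).
  by rewrite !mulr0n !(scaler0, oppr0, addr0) ur0 oppr0.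
case: (eqVneq j ord_max) => [->|jm] ij; rewrite ?andbT ?andbF /= => n1 n2.
  rewrite comm_dl !delta_simp !(eq_sym ord0) !(eq_sym ord_max) (negPf n1) (negPf im).
  by rewrite !mulr0n !(scaler0, oppr0, addr0) ll0.
rewrite comm_dd /mx_comm !delta_simp nx_inj // !(eq_sym (nx j)) nx_inj //.
rewrite (negPf ij) !(eq_sym j) (negPf ij).
by rewrite !mulr0n !(scaler0, oppr0, addr0) dg0.
Qed.

Lemma gim_relations_gl q : q != 0 ->
  gim_relations (L := gl_lie K (n.+1 + n.+1)) (gE q) (gF q) gH.
Proof.
move=> q0; have EE i j : i != j -> mx_comm (gE q i) (mx_comm (gE q i) (gE q j)) = 0.
  by move=> ij; rewrite mx_comm_sandwich ?gE_square ?gE_sandwichE.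
have EF i j : i != j -> mx_comm (gE q i) (mx_comm (gE q i) (gF q j)) = 0.
  by move=> ij; rewrite mx_comm_sandwich ?gE_square ?gE_sandwichF.
have FE i j : i != j -> mx_comm (gF q i) (mx_comm (gF q i) (gE q j)) = 0.
  by move=> ij; rewrite mx_comm_sandwich ?gF_square ?gF_sandwichE.
have FF i j : i != j -> mx_comm (gF q i) (mx_comm (gF q i) (gF q j)) = 0.
  by move=> ij; rewrite mx_comm_sandwich ?gF_square ?gF_sandwichF.
have cFF i j : i != j -> 0 <= gimM i j -> mx_comm (gF q i) (gF q j) = 0.
  by move=> ij mij; apply: trmx_inj; rewrite trmx_comm !tr_gF comm_gE_gE ?oppr0 ?trmx0.
split; [|split].
- by move=> i j; split; [exact: comm_gH_gE|exact: comm_gH_gF|exact: comm_gE_gF].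
- move=> i j ij mij; split.
  + exact: comm_gE_gF0.
  + by rewrite /= mx_commC comm_gE_gF0 ?oppr0 // ?(gimMC j) // eq_sym.
  (* The exponent $1 - m_{ij}$ is 2 for adjacent nodes, where [EE] applies, and 1 for $m_{ij} = 0$,
     where the generators commute. *)
  + have := comm_gE_gE q ij; have := EE i j ij; move: ij mij.
    by case: gimMP => [->|*|*|*|*|*] //; rewrite ?eqxx //=; auto.
  + have := cFF i j ij; have := FF i j ij; move: ij mij.
    by case: gimMP => [->|*|*|*|*|*] //; rewrite ?eqxx //=; auto.
- move=> i j ij mij; split.
  + by apply: comm_gE_gE => //; exact: Order.POrderTheory.ltW.
  + by apply: cFF => //; exact: Order.POrderTheory.ltW.
  + have := EF i j ij; move: ij mij.
    by case: gimMP => [->|*|*|*|*|*] //; rewrite ?eqxx //=; auto.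
  + have := FE i j ij; move: ij mij.
    by case: gimMP => [->|*|*|*|*|*] //; rewrite ?eqxx //=; auto.
Qed.

End Generators.

(** * Generation *)

Definition lin_closed (K : fieldType) (V : lmodType K) (P : V -> Prop) :=
  P 0 /\ forall k x y, P x -> P y -> P (k *: x + y).

Section LinClosed.
Variables (K : fieldType) (V : lmodType K) (P : V -> Prop).
Hypothesis Pcl : lin_closed P.

Lemma lin_closed0 : P 0. Proof. by case: Pcl. Qed.

Lemma lin_closedD x y : P x -> P y -> P (x + y).
Proof. by move=> Px Py; rewrite -[x]scale1r; case: Pcl => _; apply. Qed.

Lemma lin_closedZ k x : P x -> P (k *: x).
Proof. by move=> Px; rewrite -[_ *: _]addr0; case: Pcl => P0; apply. Qed.

Lemma lin_closedZV k x : k != 0 -> P (k *: x) -> P x.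
Proof. by move=> k0 /(lin_closedZ k^-1); rewrite scalerA mulVf // scale1r. Qed.

Lemma lin_closedN x : P x -> P (- x).
Proof. by move=> Px; rewrite -scaleN1r; apply: lin_closedZ. Qed.

End LinClosed.

Lemma lin_closed_comp (K : fieldType) (V W : lmodType K) (f : V -> W) (P : W -> Prop) :
  (forall k x y, f (k *: x + y) = k *: f x + f y) ->
  lin_closed P -> lin_closed (fun x => P (f x)).
Proof.
move=> flin [P0 Plin]; split=> [|k x y Px Py]; last by rewrite flin; exact: Plin.
suff -> : f 0 = 0 by [].
by have := flin (-1) 0 0; rewrite scaler0 addr0 scaleN1r addNr.
Qed.

Lemma lin_closed_delta (K : fieldType) (n : nat) (P : 'M[K]_n -> Prop) :
  lin_closed P -> (forall i j, P (delta_mx i j)) -> forall X, P X.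
Proof.
move=> Pcl Pd X; rewrite [X]matrix_sum_delta.
apply: big_ind => [|x y|i _]; [exact: lin_closed0|exact: lin_closedD|].
apply: big_ind => [|x y|j _]; [exact: lin_closed0|exact: lin_closedD|].
exact: lin_closedZ.
Qed.

(** Supplies the intermediate index through which commutators of matrix units are routed; there are
    $n + 1 \geq 3$ indices. *)
Lemma exists_ord_neq2 (n : nat) (i j : 'I_n.+1) : (2 <= n)%N ->
  exists k : 'I_n.+1, k != i /\ k != j.
Proof.
move=> n2; have [k] : exists k, k \in ~: [set i; j].
  apply/set0Pn; rewrite -card_gt0 cardsCs setCK card_ord cards2; case: (_ != _) => /=; lia.
by rewrite !inE negb_or => /andP[ki kj]; exists k.
Qed.

(* The form preserved by the factor of parameter [q = 1] (symplectic) or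
   [q = -1] (orthogonal). *)
Definition formJ (K : fieldType) (n : nat) (q : K) : 'M[K]_(n + n) :=
  block_mx 0 1%:M (- q%:M) 0.

(** The simple algebra that parameter $q$ is meant to generate: the algebra of the form for $q = \pm
    1$, and $sl$ for every other $q$. *)
Definition in_factor (K : fieldType) (n : nat) (q : K) (Z : 'M[K]_(n + n)) : Prop :=
  if q ^+ 2 == 1 then Z^T *m formJ n q + formJ n q *m Z = 0 else \tr Z = 0.

Lemma in_factor_block (K : fieldType) (n : nat) (q : K) (X b c Y : 'M[K]_n) :
  q ^+ 2 = 1 ->
  in_factor q (block_mx X b c Y) <-> [/\ Y = - X^T, b^T = q *: b & c^T = q *: c].
Proof.
move=> q2; rewrite /in_factor q2 eqxx /formJ tr_block_mx !block_simp.
rewrite !mulmx1 !mul1mx !mulmxN !mulNmx !mul_mx_scalar !mul_scalar_mx.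
have qq : q * q = 1 by rewrite -expr2.
split=> [|[-> bq cq]].
  rewrite -[0]block_mx0 => /eq_block_mx [h1 h2 h3 h4].
  split; first by apply/eqP; rewrite -addr_eq0 addrC h2.
    by apply/eqP; rewrite -subr_eq0 h4.
  (* The upper left corner reads $c = q c^T$; multiplying by $q$ and using $q^2 = 1$ gives the
     stated form. *)
  by move/eqP: h1; rewrite addrC subr_eq0 => /eqP {2}->; rewrite scalerA qq scale1r.
rewrite bq cq linearN /= trmxK scalerN opprK scalerA qq scale1r.
by rewrite addNr !subrr block_mx0.
Qed.

Lemma mxtrace_delta (K : fieldType) (n : nat) (i j : 'I_n) :
  \tr (delta_mx i j : 'M[K]_n) = (i == j)%:R.
Proof.
rewrite /mxtrace (bigD1 i) //= mxE eqxx big1 ?addr0 // => k /negPf ki.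
by rewrite mxE ki.
Qed.

(** * A single factor is spanned by its root vectors and their brackets *)

Section OneFactor.
Variables (K : fieldType) (n : nat) (q : K) (N : 'M[K]_(n.+1 + n.+1) -> Prop).
Hypotheses (n_ge2 : (2 <= n)%N) (two_neq0 : 2%:R != 0 :> K) (q_neq0 : q != 0).
Hypothesis Ncl : lin_closed N.
Hypothesis Nbr : forall X Y, N X -> N Y -> N (mx_comm X Y).
Hypothesis NuE : forall i j, N (uE q i j).
Hypothesis NlE : forall i j, N (lE q i j).


Let NZV := lin_closedZV Ncl.

(** The conditions on the blocks of $Z$ give $2b = b + q b^T$ and $2c = c + q^{-1} c^T$, which are
    combinations of the [uE] and [lE]. The diagonal part $\mathrm{diag}(X, -X^T)$ is treated on
    matrix units. *)
Lemma factor_full_form Z :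
  (forall i j, i != j -> N (dE 1 1 i j)) -> q ^+ 2 = 1 -> in_factor q Z -> N Z.
Proof.
move=> NdE q2; rewrite -[Z]submxK => /(in_factor_block _ _ _ _ q2)[-> bq cq].
have qq : q * q = 1 by rewrite -expr2.
rewrite block_dul; apply: lin_closedD => //; last apply: lin_closedD => //.
- move: (ulsubmx Z) => X; move: X; apply: lin_closed_delta.
    by apply: lin_closed_comp Ncl => k x y; rewrite dg_lin; congr dg; mxring.
  move=> i j; case: (eqVneq i j) => [<-|ij]; last first.
    by have := NdE i j ij; rewrite /dE !scale1r trmx_delta.
  have [k [ki _]] := exists_ord_neq2 i i n_ge2.
  have ik : i != k by rewrite eq_sym.
  (* The two brackets have upper blocks $E_{ii} + E_{kk}$ and $E_{ii} - E_{kk}$, so their sum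
     isolates $2E_{ii}$. *)
  have H := lin_closedD Ncl (Nbr (NuE i k) (NlE k i))
    (Nbr (NdE i k ik) (NdE k i ki)).
  apply: (@NZV 2%:R) => //; move: H.
  rewrite comm_uElE_diag // comm_dEdE_diag //.
  rewrite dgD dgZ trmx_delta.
  by congr (N (dg _ _)); mxring.
- have NX X : N (ur (X + q *: X^T)).
    move: X; apply: lin_closed_delta => [|i j]; last by rewrite trmx_delta; exact: NuE.
    by apply: lin_closed_comp Ncl => k x y; rewrite ur_lin; congr ur; mxring.
  apply: (@NZV 2%:R) => //; rewrite urZ.
  by have := NX (ursubmx Z); rewrite bq scalerA qq scale1r -mulr2n scaler_nat.
- have NX X : N (ll (X + q^-1 *: X^T)).
    move: X; apply: lin_closed_delta => [|i j]; last by rewrite trmx_delta; exact: NlE.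
    by apply: lin_closed_comp Ncl => k x y; rewrite ll_lin; congr ll; mxring.
  apply: (@NZV 2%:R) => //; rewrite llZ.
  by have := NX (dlsubmx Z); rewrite cq scalerA mulVf // scale1r -mulr2n scaler_nat.
Qed.

(** Once the diagonal blocks are separated, brackets with [uE] and [lE] produce every unit of the
    off-diagonal blocks. Brackets of those units yield $\mathrm{diag}(E_{ii}, -E_{jj})$, hence all
    diagonal matrices of trace zero. *)
Lemma factor_full_sl Z :
  (forall i j, i != j -> N (dE 1 0 i j)) -> (forall i j, i != j -> N (dE 0 1 i j)) ->
  \tr Z = 0 -> N Z.
Proof.
move=> Nd1 Nd2.
have Nur b : N (ur b).
  move: b; apply: lin_closed_delta => [|i j].
    by apply: lin_closed_comp Ncl => k x y; rewrite ur_lin.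
  have [k [ki kj]] := exists_ord_neq2 i j n_ge2.
  by rewrite -(comm_dEuE1 q i kj); apply: Nbr => //; apply: Nd1; rewrite eq_sym.
have Nll b : N (ll b).
  move: b; apply: lin_closed_delta => [|i j].
    by apply: lin_closed_comp Ncl => k x y; rewrite ll_lin.
  have [k [ki kj]] := exists_ord_neq2 i j n_ge2.
  apply: (@NZV (-1)); first by rewrite oppr_eq0 oner_eq0.
  by rewrite -(comm_dElE1 q i kj); apply: Nbr => //; apply: Nd2.
have Ndiag i j : N (dg (delta_mx i i) (- delta_mx j j)).
  by have := Nbr (Nur (delta_mx i j)) (Nll (delta_mx j i)); rewrite comm_ul !mul_delta_mx.
(* Subtracting the trace at one fixed diagonal position makes the claim linear in an arbitrary $X$,
   so matrix units suffice. *)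
have NX X : N (dg (X - \tr X *: delta_mx ord0 ord0) 0).
  move: X; apply: lin_closed_delta => [|i j].
    apply: lin_closed_comp Ncl => k x y; rewrite dg_lin linearP /= scaler0 addr0.
    by congr dg; mxring.
  case: (eqVneq i j) => [<-|ij]; last first.
    have := Nd1 i j ij; rewrite /dE scale0r oppr0 scale1r mxtrace_delta (negPf ij).
    by rewrite scale0r subr0.
  have := Ncl.2 (-1) _ _ (Ndiag ord0 ord0) (Ndiag i ord0).
  rewrite dg_lin !scaleN1r opprK addrN mxtrace_delta eqxx scale1r.
  by rewrite addrC.
have NY X : N (dg 0 (X - \tr X *: delta_mx ord0 ord0)).
  move: X; apply: lin_closed_delta => [|i j].
    apply: lin_closed_comp Ncl => k x y; rewrite dg_lin linearP /= scaler0 addr0.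
    by congr dg; mxring.
  case: (eqVneq i j) => [<-|ij]; last first.
    have := lin_closedN Ncl (Nd2 j i _); rewrite eq_sym ij => /(_ isT).
    rewrite /dE scale0r scale1r mxtrace_delta (negPf ij) scale0r subr0.
    by rewrite -scaleN1r dgZ scaler0 scaleN1r opprK.
  have := Ncl.2 (-1) _ _ (Ndiag ord0 i) (Ndiag ord0 ord0).
  rewrite dg_lin !scaleN1r addNr mxtrace_delta eqxx scale1r opprK.
  by [].
rewrite -[Z]submxK mxtrace_block block_dul => trZ.
apply: lin_closedD => //; last exact: lin_closedD.
set X := ulsubmx Z in trZ *; set Y := drsubmx Z in trZ *.
(* Because $\mathrm{tr}\,Y = -\mathrm{tr}\,X$, the two trace corrections combine into one multiple
   of $\mathrm{diag}(E_{00}, -E_{00})$. *)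
have := lin_closedD Ncl (lin_closedD Ncl (NX X) (NY Y))
  (lin_closedZ Ncl (\tr X) (Ndiag ord0 ord0)).
have -> : \tr Y = - \tr X by apply/eqP; rewrite -addr_eq0 addrC trZ.
set E := delta_mx _ _; set x := \tr X; move: E x => E x.
suff -> : dg (X - x *: E) 0 + dg 0 (Y - - x *: E) + x *: dg E (- E) = dg X Y by [].
rewrite dgZ !dgD.
by congr dg; mxring.
Qed.

End OneFactor.

(** Indices are changed one at a time, starting from an off-diagonal pair. Moves leave only
    off-diagonal pairs, so these are all reached first and the diagonal ones last. *)
Lemma ord_pair_reach (n : nat) (P : 'I_n.+1 -> 'I_n.+1 -> Prop) (i0 j0 : 'I_n.+1) :
  (2 <= n)%N ->
  (forall i j k, i != j -> k != i -> P i j -> P k j) ->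
  (forall i j k, i != j -> k != j -> P i j -> P i k) ->
  i0 != j0 -> P i0 j0 -> forall k l, P k l.
Proof.
move=> n2 Pl Pr ij0 P0.
have left i j k : i != j -> P i j -> P k j.
  by move=> ij Pij; case: (eqVneq k i) => [->|ki] //; apply: Pl ki Pij.
have right i j k : i != j -> P i j -> P i k.
  by move=> ij Pij; case: (eqVneq k j) => [->|kj] //; apply: Pr kj Pij.
have off k l : k != l -> P k l.
  move=> kl; case: (eqVneq k j0) => [kj|kj].
    have [m [mi mj]] := exists_ord_neq2 i0 j0 n2.
    apply: (right k m); first by rewrite kj eq_sym.
    apply: (left i0); first by rewrite eq_sym.
    exact: right P0.
  by apply: (right k j0) => //; exact: left P0.
move=> k l; have [m [mk _]] := exists_ord_neq2 l l n2.
exact: left (off m l mk).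
Qed.

(** * The subalgebra [S] of the product of all factors generated by the families $e_i$, $f_i$ *)

Section Generation.
Variables (K : fieldType) (n : nat).
Hypotheses (n_ge2 : (2 <= n)%N) (two_neq0 : 2%:R != 0 :> K).
Variables (T : finType) (q : T -> K).
Hypotheses (q_neq0 : forall t, q t != 0).
Hypotheses (q_sep : forall s t, s != t -> (q s != q t) && (q s * q t != 1)).
Variable S : (T -> 'M[K]_(n.+1 + n.+1)) -> Prop.
Hypothesis Sext : forall Z Z', Z =1 Z' -> S Z -> S Z'.
Hypothesis Slin : forall k Z Z', S Z -> S Z' -> S (fun t => k *: Z t + Z' t).
Hypothesis Sbr : forall Z Z', S Z -> S Z' -> S (fun t => mx_comm (Z t) (Z' t)).
Hypothesis SgE : forall i, S (fun t => gE (q t) i).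
Hypothesis SgF : forall i, S (fun t => gF (q t) i).

Lemma S0 : S (fun=> 0).
Proof.
by apply: Sext (Slin (-1) (SgE ord0) (SgE ord0)) => t; rewrite scaleN1r addNr.
Qed.

Lemma SZ k Z : S Z -> S (fun t => k *: Z t).
Proof. by move=> SX; apply: Sext (Slin k SX S0) => t; rewrite addr0. Qed.

Lemma SD Z Z' : S Z -> S Z' -> S (fun t => Z t + Z' t).
Proof. by move=> SX SY; apply: Sext (Slin 1 SX SY) => t; rewrite scale1r. Qed.

Definition dlam (l m : T -> K) :=
  forall i j, i != j -> S (fun t => dE (l t) (m t) i j).

Lemma dlam_ext l m l' m' : l =1 l' -> m =1 m' -> dlam l m -> dlam l' m'.
Proof. by move=> el em H i j ij; apply: Sext (H i j ij) => t; rewrite el em. Qed.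

(** Neighbouring indices are the generators themselves; larger distances follow by induction, with
    $E_{ij} = [E_{ik}, E_{kj}]$ for $k = j - 1$, and likewise for $E_{ji}$. *)
Lemma dlam1 : dlam (fun=> 1) (fun=> 1).
Proof.
suff H d (i j : 'I_n.+1) : j = (i + d.+1)%N :> nat ->
    S (fun=> dE 1 1 i j) /\ S (fun=> dE 1 1 j i).
  move=> i j; rewrite -val_eqE neq_ltn => /orP[ij|ij].
    apply: (proj1 (H (j - i).-1 i j _)).
    by rewrite prednK ?subn_gt0 // subnKC // ltnW.
  apply: (proj2 (H (i - j).-1 j i _)).
  by rewrite prednK ?subn_gt0 // subnKC // ltnW.
elim: d i j => [|d IH] i j ji.
  have im : i != ord_max by rewrite -val_eqE /=; have := ltn_ord j; lia.
  have -> : j = nx i by apply: val_inj; rewrite /= val_nx // ji addn1.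
  by split; [have := SgE i|have := SgF i]; rewrite /gE /gF (negPf im).
have kn : (i + d.+1 < n.+1)%N by have := ltn_ord j; lia.
pose k := Ordinal kn.
have [ik ki] := IH i k erefl.
have km : k != ord_max by rewrite -val_eqE /=; have := ltn_ord j; lia.
have jk : j = nx k by apply: val_inj; rewrite /= val_nx //= ji addnS.
have [kj jk'] : S (fun=> dE 1 1 k j) /\ S (fun=> dE 1 1 j k).
  by rewrite jk; split; [have := SgE k|have := SgF k]; rewrite /gE /gF (negPf km).
have ij : i != j by rewrite -val_eqE /=; lia.
split.
  by apply: Sext (Sbr ik kj) => t; rewrite comm_dEdE // !mulr1.
by apply: Sext (Sbr jk' ki) => t; rewrite comm_dEdE ?mulr1 // eq_sym.
Qed.

(** The last generator $e_n$ provides the pair of end indices; brackets with [dE 1 1] then change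
    either index. *)
Lemma SuE i j : S (fun t => uE (q t) i j).
Proof.
have S1 := SgE ord_max; rewrite /gE eqxx in S1.
move: i j; apply: (ord_pair_reach n_ge2 _ _ (ord0_neq_max n_ge2))
  => [i j k ij ki Sij|i j k ij kj Sij|].
- by apply: Sext (Sbr (dlam1 ki) Sij) => t; rewrite comm_dEuE.
- by apply: Sext (Sbr (dlam1 kj) Sij) => t; rewrite comm_dEuE'.
- exact: S1.
Qed.

Lemma SlE i j : S (fun t => lE (q t) i j).
Proof.
have S1 := SgF ord_max; rewrite /gF eqxx in S1.
have m0 : (ord_max : 'I_n.+1) != ord0 by rewrite eq_sym ord0_neq_max.
move: i j; apply: (ord_pair_reach n_ge2 _ _ m0) => [i j k ij ki Sij|i j k ij kj Sij|].
- have ik : i != k by rewrite eq_sym.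
  apply: Sext (SZ (-1) (Sbr (dlam1 ik) Sij)) => t.
  by rewrite comm_dElE // scalerA mulrNN mulr1 scale1r.
- have jk : j != k by rewrite eq_sym.
  apply: Sext (SZ (-1) (Sbr (dlam1 jk) Sij)) => t.
  by rewrite comm_dElE' // scalerA mulrNN mulr1 scale1r.
- exact: S1.
Qed.

Lemma dlamM l m l' m' : dlam l m -> dlam l' m' ->
  dlam (fun t => l t * l' t) (fun t => m t * m' t).
Proof.
move=> H H' i j ij; have [k [ki kj]] := exists_ord_neq2 i j n_ge2.
rewrite eq_sym in ki.
by apply: Sext (Sbr (H i k ki) (H' k j kj)) => t; rewrite comm_dEdE.
Qed.

Lemma dlam_lin a l m l' m' : dlam l m -> dlam l' m' ->
  dlam (fun t => a * l t + l' t) (fun t => a * m t + m' t).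
Proof.
move=> H H' i j ij.
apply: Sext (Slin a (H i j ij) (H' i j ij)) => t.
by rewrite dg_lin; congr dg; mxring.
Qed.

Lemma dlam_qV : dlam (fun t => (q t)^-1) q.
Proof.
move=> i k ik; have [j [ji jk]] := exists_ord_neq2 i k n_ge2.
rewrite eq_sym in ji; rewrite eq_sym in jk.
by apply: Sext (Sbr (SuE i j) (SlE k j)) => t; rewrite comm_uElE.
Qed.

Lemma dlam_poly (p : {poly K}) : dlam (fun t => p.[(q t)^-1]) (fun t => p.[q t]).
Proof.
elim/poly_ind: p => [|p c IH].
  apply: dlam_ext (dlam_lin (-1) dlam1 dlam1) => t; by rewrite horner0 mulr1 addNr.
(* The constant pair $c$ is obtained as $(c - 1) \cdot 1 + 1$, since [dlam_lin] scales only its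
   first argument. *)
have := dlam_lin 1 (dlamM IH dlam_qV) (dlam_lin (c - 1) dlam1 dlam1).
by apply: dlam_ext => t; rewrite hornerMXaddC mulr1 subrK mul1r.
Qed.

(** * Isolating one factor by polynomial interpolation *)

Section Separation.
Variable t : T.

(** Vanishes at $q_s$ and $1/q_s$ for all $s \neq t$; by [q_sep] it vanishes at neither $q_t$ nor
    $1/q_t$. *)
Let Pt : {poly K} :=
  \prod_(s | s != t) (('X - (q s)%:P) * ('X - ((q s)^-1)%:P)).

Let Pt_neq0 x : x = q t \/ x = (q t)^-1 -> Pt.[x] != 0.
Proof.
move=> xt; rewrite horner_prod; apply/prodf_neq0 => s st.
have /andP[qst qqst] := q_sep st.
rewrite hornerM mulf_neq0 // !hornerE subr_eq0; case: xt => ->.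
- by rewrite eq_sym.
- by apply: contra qqst => /eqP <-; rewrite mulVf.
- by apply: contra qqst => /eqP->; rewrite mulfV.
- by rewrite (inj_eq invr_inj) eq_sym.
Qed.

Let Pt_eq0 s x : s != t -> x = q s \/ x = (q s)^-1 -> Pt.[x] = 0.
Proof.
move=> st xs; rewrite horner_prod (bigD1 s) //= !hornerE.
by case: xs => ->; rewrite subrr ?mul0r ?mulr0 ?mul0r.
Qed.

Let Pt_val s : s != t -> (Pt.[q s] = 0) * (Pt.[(q s)^-1] = 0).
Proof. by move=> st; split; apply: (Pt_eq0 st); [left|right]. Qed.

(** Here $1/q_t = q_t$, so normalising [Pt] at this one point makes both components the indicator of
    $t$. *)
Lemma dlam_delta : q t ^+ 2 = 1 ->
  dlam (fun s => (s == t)%:R) (fun s => (s == t)%:R).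
Proof.
move=> qt2; have qV : (q t)^-1 = q t.
  by apply: (mulfI (q_neq0 t)); rewrite mulfV // -expr2 qt2.
have p0 : Pt.[q t] != 0 by apply: Pt_neq0; left.
apply: dlam_ext (dlam_poly ((Pt.[q t])^-1 *: Pt)) => s; rewrite hornerZ;
  by case: (eqVneq s t) => [->|st]; rewrite ?qV ?mulVf ?(Pt_val st) ?mulr0.
Qed.

(** Now $q_t \neq 1/q_t$, so the extra factor $X - q_t$ kills the second component at $t$ and keeps
    the first one nonzero. *)
Lemma dlam_deltal : q t ^+ 2 != 1 -> dlam (fun s => (s == t)%:R) (fun=> 0).
Proof.
move=> qt2; pose p := Pt * ('X - (q t)%:P).
have ps s : s != t -> (p.[q s] = 0) * (p.[(q s)^-1] = 0).
  by move=> st; rewrite !hornerM !(Pt_val st) !mul0r.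
have pt : p.[q t] = 0 by rewrite hornerM hornerXsubC subrr mulr0.
have p0 : p.[(q t)^-1] != 0.
  rewrite hornerM mulf_neq0 ?Pt_neq0 //; first by right.
  rewrite !hornerE subr_eq0; apply: contra qt2 => /eqP E.
  by rewrite expr2 -{1}E mulVf.
apply: dlam_ext (dlam_poly ((p.[(q t)^-1])^-1 *: p)) => s; rewrite hornerZ;
  by case: (eqVneq s t) => [->|st]; rewrite ?pt ?mulVf ?(ps s st) ?mulr0.
Qed.

Lemma dlam_deltar : q t ^+ 2 != 1 -> dlam (fun=> 0) (fun s => (s == t)%:R).
Proof.
move=> qt2; pose p := Pt * ('X - ((q t)^-1)%:P).
have ps s : s != t -> (p.[q s] = 0) * (p.[(q s)^-1] = 0).
  by move=> st; rewrite !hornerM !(Pt_val st) !mul0r.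
have pt : p.[(q t)^-1] = 0 by rewrite hornerM hornerXsubC subrr mulr0.
have p0 : p.[q t] != 0.
  rewrite hornerM mulf_neq0 ?Pt_neq0 //; first by left.
  rewrite !hornerE subr_eq0; apply: contra qt2 => /eqP E.
  by rewrite expr2 {1}E mulVf.
apply: dlam_ext (dlam_poly ((p.[q t])^-1 *: p)) => s; rewrite hornerZ;
  by case: (eqVneq s t) => [->|st]; rewrite ?pt ?mulVf ?(ps s st) ?mulr0.
Qed.

Let N Z := S (fun s => if s == t then Z else 0).

Let Ncl : lin_closed N.
Proof.
split=> [|k X Y NX NY]; first by apply: Sext S0 => s; rewrite if_same.
by apply: Sext (Slin k NX NY) => s; case: eqP => // _; rewrite scaler0 addr0.
Qed.

(** The elements of [S] supported at $t$ form an ideal: one supported argument localises the whole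
    bracket. *)
Let Nbr Z (W : T -> 'M[K]_(n.+1 + n.+1)) : N Z -> S W -> N (mx_comm Z (W t)).
Proof.
move=> NZ SW; apply: Sext (Sbr NZ SW) => s.
by case: eqP => [->|_] //; rewrite mx_comm0l.
Qed.

Let NdE a b (l m : T -> K) :
  (forall s, l s = if s == t then a else 0) ->
  (forall s, m s = if s == t then b else 0) -> dlam l m ->
  forall i j, i != j -> N (dE a b i j).
Proof.
move=> lE mE H i j ij; apply: Sext (H i j ij) => s; rewrite lE mE.
by case: eqP => // _; rewrite /dE !scale0r oppr0 dg0.
Qed.

Let NdE10 : q t ^+ 2 != 1 -> forall i j, i != j -> N (dE 1 0 i j).
Proof.
by move=> qt; apply: NdE (dlam_deltal qt) => s //; case: eqP.
Qed.

Let NdE01 : q t ^+ 2 != 1 -> forall i j, i != j -> N (dE 0 1 i j).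
Proof.
by move=> qt; apply: NdE (dlam_deltar qt) => s //; case: eqP.
Qed.

Let NdE11 i j : i != j -> N (dE 1 1 i j).
Proof.
move=> ij; case: (eqVneq (q t ^+ 2) 1) => qt; last first.
  have := lin_closedD Ncl (NdE10 qt ij) (NdE01 qt ij); rewrite dgD.
  by rewrite !scale0r oppr0 addr0 add0r.
by apply: NdE (dlam_delta qt) _ _ ij => s; case: eqP.
Qed.

Lemma factor_generated Z : in_factor (q t) Z -> N Z.
Proof.
have NuE i j : N (uE (q t) i j).
  have [k [ki kj]] := exists_ord_neq2 i j n_ge2.
  (* A localised [dE] bracketed with the global family [uE] gives a localised [uE]. *)
  rewrite -(comm_dEuE (q t) i kj); apply: (Nbr (W := fun s => uE (q s) k j)).
    by apply: NdE11; rewrite eq_sym.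
  exact: SuE.
have NlE i j : N (lE (q t) i j).
  have [k [ki kj]] := exists_ord_neq2 i j n_ge2.
  apply: (@lin_closedZV _ _ _ Ncl (-1)); first by rewrite oppr_eq0 oner_eq0.
  rewrite -(comm_dElE (q t) i kj); apply: (Nbr (W := fun s => lE (q s) k j)).
    exact: NdE11.
  exact: SlE.
have NN X Y : N X -> N Y -> N (mx_comm X Y).
  by move=> NX NY; have := Nbr NX NY; rewrite eqxx.
case: (eqVneq (q t ^+ 2) 1) => qt.
  exact: (factor_full_form n_ge2 two_neq0 (q_neq0 t) Ncl NN NuE NlE NdE11).
rewrite /in_factor (negPf qt).
exact: (factor_full_sl n_ge2 Ncl NN NuE NlE (NdE10 qt) (NdE01 qt)).
Qed.

End Separation.

Lemma sum_generated Z : (forall t, in_factor (q t) (Z t)) -> S Z.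
Proof.
move=> HZ.
suff H (r : seq T) : uniq r -> S (fun s => if s \in r then Z s else 0).
  by apply: Sext (H (enum T) (enum_uniq T)) => s; rewrite mem_enum.
elim: r => [_|t r IH /= /andP[tr ur]]; first exact: S0.
apply: Sext (SD (factor_generated (HZ t)) (IH ur)) => s; rewrite in_cons.
by case: (eqVneq s t) => [->|_] /=; rewrite ?(negPf tr) ?addr0 ?add0r.
Qed.

End Generation.

(** * Realisation of the direct sum *)

Section Core.
Variables (K : fieldType) (n : nat).
Hypotheses (n_ge2 : (2 <= n)%N) (two_neq0 : 2%:R != 0 :> K).

Lemma dE_in_factor q i j : i != j -> in_factor q (dE 1 1 i j : 'M[K]_(n.+1 + n.+1)).
Proof.
move=> ij; case: (eqVneq (q ^+ 2) 1) => q2.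
  by apply/in_factor_block => //; rewrite !trmx0 scaler0 !scale1r trmx_delta.
rewrite /in_factor (negPf q2) mxtrace_block !scale1r linearN /= !mxtrace_delta.
by rewrite (eq_sym j) subrr.
Qed.

Lemma gE_in_factor q i : in_factor q (gE q i : 'M[K]_(n.+1 + n.+1)).
Proof.
rewrite /gE; case: (eqVneq i ord_max) => im; last exact: dE_in_factor (nx_neq n_ge2 im).
case: (eqVneq (q ^+ 2) 1) => q2; last first.
  by rewrite /in_factor (negPf q2) mxtrace_block mxtrace0 addr0.
apply/in_factor_block => //; rewrite !trmx0 oppr0 scaler0; split=> //.
rewrite linearD /= linearZ /= !trmx_delta scalerDr scalerA -expr2 q2 scale1r.
exact: addrC.
Qed.

Lemma gF_in_factor q i : in_factor q (gF q i : 'M[K]_(n.+1 + n.+1)).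
Proof.
rewrite /gF; case: (eqVneq i ord_max) => im.
  case: (eqVneq (q ^+ 2) 1) => q2; last first.
    by rewrite /in_factor (negPf q2) mxtrace_block mxtrace0 addr0.
  have q0 : q != 0 by apply: contra_eq_neq q2 => ->; rewrite expr0n eq_sym oner_eq0.
  have qV : q^-1 = q by apply: (mulfI q0); rewrite mulfV // -expr2 q2.
  apply/in_factor_block => //; rewrite !trmx0 oppr0 scaler0 qV; split=> //.
  rewrite linearD /= linearZ /= !trmx_delta scalerDr scalerA -expr2 q2 scale1r.
  exact: addrC.
by apply: dE_in_factor; rewrite eq_sym (nx_neq n_ge2 im).
Qed.

(** The maps [psi t] are coordinates identifying [L] with the product of the factors. The generators
    are lifted to [L], the universal property gives a homomorphism from [G], and its kernel is the
    ideal. *)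
Lemma gim_quotient_sum (T : finType) (q : T -> K) (L : lie_algebra K)
    (psi : T -> L -> gl_lie K (n.+1 + n.+1)) :
  (forall t, q t != 0) ->
  (forall s t, s != t -> (q s != q t) && (q s * q t != 1)) ->
  (forall t, lie_hom (psi t)) ->
  (forall x y, (forall t, psi t x = psi t y) -> x = y) ->
  (forall Z : T -> 'M_(n.+1 + n.+1), (forall t, in_factor (q t) (Z t)) ->
     exists x, forall t, psi t x = Z t) ->
  (forall x t, in_factor (q t) (psi t x)) ->
  forall (G : lie_algebra K) (e f h : 'I_n.+1 -> G), is_gim e f h ->
  exists I : G -> Prop, lie_ideal I /\ lie_quotient_iso I L.
Proof.
move=> q0 qsep hom inj onto sub G e f h [rel univ].
have [e' e'E] := fin_all_exists (fun i => onto _ (fun t => gE_in_factor (q t) i)).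
have [f' f'E] := fin_all_exists (fun i => onto _ (fun t => gF_in_factor (q t) i)).
pose h' i := lie_br (e' i) (f' i).
have h'E i t : psi t (h' i) = gH K i.
  by rewrite (lie_hom_br (hom t)) e'E f'E; exact: comm_gE_gF.
have rel' : gim_relations e' f' h'.
  apply: (gim_relations_pullback hom inj) => t.
  have := gim_relations_gl n_ge2 (q0 t).
  rewrite (_ : psi t \o e' = gE (q t)); last by apply: boolp.funext => i; exact: e'E.
  rewrite (_ : psi t \o f' = gF (q t)); last by apply: boolp.funext => i; exact: f'E.
  by rewrite (_ : psi t \o h' = @gH K n) //; apply: boolp.funext => i; exact: h'E.
have [[phi [phi_hom phiE]] _] := univ L e' f' h' rel'.
exists (fun x => phi x = 0); split.
  split; first exact: lie_hom0.
  split=> [k x y Ix Iy|x y Iy]; first by rewrite (lie_hom_lin phi_hom) Ix Iy scaler0 addr0.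
  rewrite (lie_hom_br phi_hom) Iy.
  have := lie_br_linr (-1) 0 0 (phi x).
  by rewrite scaler0 addr0 scaleN1r addNr.
exists phi; split=> // y.
(* The image of [phi] in coordinates is a subalgebra containing the generators, hence everything;
   joint injectivity of the [psi t] then gives surjectivity. *)
pose S Z := exists x, forall t, psi t (phi x) = Z t.
have [|k Z Z' [x xE] [x' x'E]|Z Z' [x xE] [x' x'E]|i|i||x xE] :=
    @sum_generated K n n_ge2 two_neq0 T q q0 qsep S _ _ _ _ _ (fun t => psi t y).
- by move=> Z Z' ZZ' [x xE]; exists x => t; rewrite -ZZ'.
- exists (k *: x + x') => t.
  by rewrite (lie_hom_lin phi_hom) (lie_hom_lin (hom t)) xE x'E.
- exists (lie_br x x') => t.
  by rewrite (lie_hom_br phi_hom) (lie_hom_br (hom t)) xE x'E.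
- by exists (e i) => t; have [-> _ _] := phiE i; rewrite e'E.
- by exists (f i) => t; have [_ -> _] := phiE i; rewrite f'E.
- by move=> t; exact: sub.
by exists x; apply: inj.
Qed.

End Core.

(** * Transport from size $2n$ to size $n + n$ *)

Section Cast.
Variables (K : fieldType) (m m' : nat) (mm : m = m').
Let cast := @castmx K m m m' m' (mm, mm).
Implicit Types A B : 'M[K]_m.

Lemma castmx_lie_hom :
  lie_hom (cast : gl_lie K m -> gl_lie K m').
Proof. by rewrite /cast; case: m' / mm. Qed.

Lemma castmx_tr A : (cast A)^T = cast A^T.
Proof. by rewrite /cast; case: m' / mm. Qed.

Lemma castmx_mxtrace A : \tr (cast A) = \tr A.
Proof. by rewrite /cast; case: m' / mm. Qed.

Lemma castmx_mulmx A B : cast (A *m B) = cast A *m cast B.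
Proof. by rewrite /cast; case: m' / mm. Qed.

Lemma castmx_inj : injective cast.
Proof. by rewrite /cast; case: m' / mm => A B; rewrite !castmx_id. Qed.

End Cast.

Lemma castmx_sympJ (K : fieldType) (n : nat) (nn : (2 * n = n + n)%N) :
  castmx (nn, nn) (sympJ K n) = formJ n 1.
Proof.
apply/matrixP => i j; rewrite castmxE mxE /= /formJ.
case: (split_ordP i) => i' ->; case: (split_ordP j) => j' ->.
all: rewrite ?block_mxEul ?block_mxEur ?block_mxEdl ?block_mxEdr !mxE /=.
all: have := ltn_ord i'; have := ltn_ord j'; rewrite -?val_eqE /= => hi hj.
all: rewrite ?(addnC n) ?eqn_add2r ?[_ == (_ + n)%N]ltn_eqF ?ltn_addl //=.
all: rewrite ?[(j' : nat) == i']eq_sym.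
all: by case: eqP; rewrite ?oppr0.
Qed.

Lemma is_sp_in_factor (K : fieldType) (n : nat) (nn : (2 * n = n + n)%N)
    (A : 'M[K]_(2 * n)) :
  is_sp A <-> in_factor 1 (castmx (nn, nn) A).
Proof.
rewrite /is_sp /in_factor expr1n eqxx -(castmx_sympJ K nn) castmx_tr.
rewrite -!castmx_mulmx.
have [clin _] := castmx_lie_hom K nn.
have c0 : castmx (nn, nn) (0 : 'M[K]_(2 * n)) = 0 := lie_hom0 (castmx_lie_hom K nn).
have := clin 1 (A^T *m sympJ K n) (sympJ K n *m A); rewrite !scale1r => <-.
by split=> [->|] //; rewrite -[in X in X -> _]c0 => /castmx_inj.
Qed.

(** * Change of basis between bilinear forms *)

Section Conjugation.
Variables (K : fieldType) (m : nat) (P P' : 'M[K]_m).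
Hypotheses (PP' : P *m P' = 1%:M).

Definition conj_mx (A : 'M[K]_m) := P' *m A *m P.

Lemma conj_mxK A : P *m conj_mx A *m P' = A.
Proof. by rewrite /conj_mx !mulmxA PP' mul1mx -mulmxA PP' mulmx1. Qed.

Lemma conj_mxVK A : conj_mx (P *m A *m P') = A.
Proof.
have P'P := mulmx1C PP'.
by rewrite /conj_mx !mulmxA P'P mul1mx -mulmxA P'P mulmx1.
Qed.

Lemma conj_mx_inj : injective conj_mx.
Proof. by move=> A B AB; rewrite -[A]conj_mxK AB conj_mxK. Qed.

Lemma conj_mx_lie_hom : lie_hom (conj_mx : gl_lie K m -> gl_lie K m).
Proof.
split=> [k x y|x y]; rewrite /conj_mx.
  by rewrite mulmxDr mulmxDl -scalemxAr -scalemxAl.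
rewrite /= /mx_comm mulmxBr mulmxBl !mulmxA.
by rewrite -!(mulmxA _ P P') PP' !mulmx1.
Qed.

(** The right-hand expression equals $P^T (A^T + A) P$, and $P$ is invertible: skew matrices become
    those preserving the Gram form $P^T P$. *)
Lemma conj_mx_form A : A^T + A = 0 <->
  (conj_mx A)^T *m (P^T *m P) + P^T *m P *m conj_mx A = 0.
Proof.
have PP'T : P'^T *m P^T = 1%:M by rewrite -trmx_mul PP' trmx1.
have -> : (conj_mx A)^T *m (P^T *m P) = P^T *m A^T *m P.
  by rewrite /conj_mx !trmx_mul !mulmxA -(mulmxA _ P'^T) PP'T mulmx1.
have -> : P^T *m P *m conj_mx A = P^T *m A *m P.
  by rewrite /conj_mx !mulmxA -(mulmxA _ P P') PP' mulmx1.
rewrite -mulmxDl -mulmxDr; split=> [->|H]; first by rewrite mulmx0 mul0mx.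
have := congr1 (fun B => P'^T *m B *m P') H.
by rewrite mulmx0 mul0mx -!mulmxA PP' mulmx1 !mulmxA PP'T mul1mx.
Qed.

End Conjugation.

Section Orthogonal.
Variables (K : numClosedFieldType) (n : nat).

Lemma formJN1 : formJ n (-1 : K) = block_mx 0 1%:M 1%:M 0.
Proof. by rewrite /formJ raddfN opprK. Qed.

(* Over a field containing a square root of [-1], the split symmetric form is
   equivalent to the identity. *)
Lemma split_form_gram : exists P P' : 'M[K]_(n + n),
  P *m P' = 1%:M /\ P^T *m P = formJ n (-1).
Proof.
(* The columns are the isotropic vectors $\epsilon_k + i\epsilon_{n+k}$ and $(\epsilon_k -
   i\epsilon_{n+k})/2$, which pair to 1. *)
pose P : 'M[K]_(n + n) := block_mx 1%:M (2^-1)%:M 'i%:M (- 'i / 2)%:M.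
have PTP : P^T *m P = formJ n (-1).
  rewrite formJN1 /P tr_block_mx !tr_scalar_mx mulmx_block -!scalar_mxM -!raddfD /=.
  have ii : 'i * 'i = -1 :> K by rewrite -expr2 Num.Theory.sqrCi.
  have two0 : 2 != 0 :> K by rewrite Num.Theory.pnatr_eq0.
  have e1 : 1 * 1 + 'i * 'i = 0 :> K by rewrite ii mulr1 addrN.
  have e2 : 1 * 2^-1 + 'i * (- 'i / 2) = 1 :> K.
    by rewrite mulrA mulrN ii opprK -mulrDl; field.
  have e3 : 2^-1 * 1 + - 'i / 2 * 'i = 1 :> K by rewrite mulrC (mulrC _ 'i) e2.
  have e4 : 2^-1 * 2^-1 + - 'i / 2 * (- 'i / 2) = 0 :> K.
    by rewrite mulrACA mulrNN ii mulN1r addrN.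
  by rewrite e1 e2 e3 e4 raddf0.
(* With $J = P^T P$ and $J^2 = 1$, the inverse of $P$ is $J P^T$. *)
exists P, (formJ n (-1) *m P^T); split=> //; apply: mulmx1C.
rewrite -mulmxA PTP formJN1 mulmx_block !mulmx0 !mul0mx !mul1mx !addr0 !add0r.
by rewrite -scalar_mx_block.
Qed.

End Orthogonal.

Lemma is_so_in_factor (K : fieldType) (n : nat) (nn : (2 * n = n + n)%N)
    (P P' : 'M[K]_(n + n)) (A : 'M[K]_(2 * n)) :
  P *m P' = 1%:M -> P^T *m P = formJ n (-1) ->
  is_so A <-> in_factor (-1) (conj_mx P P' (castmx (nn, nn) A)).
Proof.
move=> PP' PTP; rewrite /in_factor sqrrN expr1n eqxx -PTP.
rewrite -(conj_mx_form PP') castmx_tr /is_so.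
have clin := lie_hom_lin (castmx_lie_hom K nn).
have := clin 1 A^T A; rewrite !scale1r => <-.
have c0 : castmx (nn, nn) (0 : 'M[K]_(2 * n)) = 0 := lie_hom0 (castmx_lie_hom K nn).
split=> [->|]; first by rewrite addNr.
by rewrite -[X in _ = X -> _]c0 => /castmx_inj/eqP; rewrite addr_eq0 => /eqP.
Qed.

Lemma is_sl_in_factor (K : fieldType) (n : nat) (nn : (2 * n = n + n)%N) (q : K)
    (A : 'M[K]_(2 * n)) : q ^+ 2 != 1 ->
  is_sl A <-> in_factor q (castmx (nn, nn) A).
Proof. by move=> q2; rewrite /in_factor (negPf q2) castmx_mxtrace. Qed.

(** * Indices and parameters of the simple summands *)

Section FactorIndex.
Variables (K : numClosedFieldType) (a : nat) (c d : bool).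

(** The booleans are read as 0 or 1, so ['I_c] and ['I_d] are empty or singletons. *)
Definition factor_index : finType := ('I_a + ('I_c + 'I_d))%type.

(** The $sl$ factors get the integers from 2 on. These are distinct, have squares other than 1, and
    no product of two parameters with different indices equals 1, even when $1$ and $-1$ are
    included. *)
Definition factor_param (t : factor_index) : K :=
  match t with
  | inl s => s.+2%:R
  | inr (inl _) => 1
  | inr (inr _) => -1
  end.

Lemma factor_param_neq0 t : factor_param t != 0.
Proof.
case: t => [s|[s|s]] /=; first by rewrite Num.Theory.pnatr_eq0.
  exact: oner_neq0.
by rewrite oppr_eq0 oner_neq0.
Qed.

Lemma factor_param_sq s : factor_param (inl s) ^+ 2 != 1.
Proof. by rewrite /= -natrX Num.Theory.pnatr_eq1. Qed.

Lemma factor_param_sep s t : s != t ->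
  (factor_param s != factor_param t) && (factor_param s * factor_param t != 1).
Proof.
have natN (m : nat) : (m.+1%:R == -1 :> K) = false.
  by rewrite -addr_eq0 natr1 Num.Theory.pnatr_eq0.
have oneN : (1 == -1 :> K) = false := natN 0%N.
have bord (b : bool) (x y : 'I_b) : x = y.
  by apply: val_inj; case: b x y => -[[|x] hx] [[|y] hy].
case: s t => [s|[s|s]] [t|[t|t]] /= st.
- rewrite Num.Theory.eqr_nat -natrM Num.Theory.pnatr_eq1 andbT.
  by apply: contra st => /eqP[/val_inj ->].
- by rewrite mulr1 Num.Theory.pnatr_eq1.
- by rewrite natN mulrN1 eqr_oppLR natN.
- by rewrite mul1r eq_sym Num.Theory.pnatr_eq1.
- by rewrite (bord c s t) eqxx in st.
- by rewrite mul1r oneN eq_sym oneN.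
- by rewrite mulN1r [-1 == _]eq_sym natN eqr_oppLR natN.
- by rewrite mulr1 [-1 == _]eq_sym oneN.
- by rewrite (bord d s t) eqxx in st.
Qed.

End FactorIndex.

Lemma gim_quotient (K : numClosedFieldType) (n a : nat) (c d : bool)
    (L : lie_algebra K) (G : lie_algebra K) (e f h : 'I_n.+1 -> G) :
  (2 <= n)%N -> lie_iso_sum n.+1 a c d L -> is_gim e f h ->
  exists I : G -> Prop, lie_ideal I /\ lie_quotient_iso I L.
Proof.
move=> n2 [psiA [psiC [psiD [lin br inj sub onto]]]] HG.
have nn : (2 * n.+1 = n.+1 + n.+1)%N by rewrite mul2n addnn.
have [P [P' [PP' PTP]]] := split_form_gram K n.+1.
pose cast := @castmx K _ _ _ _ (nn, nn).
(* The orthogonal component is given by skew matrices, so it is conjugated to the split form on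
   which the generators are defined. *)
pose psi (t : factor_index a c d) (x : L) : gl_lie K (n.+1 + n.+1) :=
  match t with
  | inl s => cast (psiA s x)
  | inr (inl _) => cast (psiC x)
  | inr (inr _) => conj_mx P P' (cast (psiD x))
  end.
have castH : lie_hom (cast : gl_lie K (2 * n.+1) -> gl_lie K (n.+1 + n.+1)).
  exact: castmx_lie_hom.
have conjH := conj_mx_lie_hom PP'.
have two0 : 2%:R != 0 :> K by rewrite Num.Theory.pnatr_eq0.
apply: (@gim_quotient_sum K n n2 two0 _ (@factor_param K a c d) L psi _ _ _ _ _ _ G e f h HG).
- exact: factor_param_neq0.
- exact: factor_param_sep.
- case=> [s|[s|s]]; split=> [k x y|x y] /=.
  + by have [-> _ _] := lin k x y; exact: (lie_hom_lin castH).
  + by have [-> _ _] := br x y; exact: (lie_hom_br castH).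
  + by have [_ -> _] := lin k x y; exact: (lie_hom_lin castH).
  + by have [_ -> _] := br x y; exact: (lie_hom_br castH).
  + have [_ _ ->] := lin k x y.
    by rewrite (lie_hom_lin castH) (lie_hom_lin conjH).
  + have [_ _ ->] := br x y.
    by rewrite (lie_hom_br castH) (lie_hom_br conjH).
- move=> x y xy; have [_ xC xD] := sub x; have [_ yC yD] := sub y.
  apply: inj => [s||]; first exact: castmx_inj (xy (inl s)).
    have [c1|/negPf c0] := boolP c; last by move: xC yC; rewrite c0 => -> ->.
    have c_gt0 : (0 < c)%N by rewrite lt0b.
    exact: castmx_inj (xy (inr (inl (Ordinal c_gt0)))).
  have [d1|/negPf d0] := boolP d; last by move: xD yD; rewrite d0 => -> ->.
  have d_gt0 : (0 < d)%N by rewrite lt0b.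
  exact: castmx_inj (conj_mx_inj PP' (xy (inr (inr (Ordinal d_gt0))))).
- move=> Z HZ; pose uncast := @castmx K _ _ _ _ (esym nn, esym nn).
  have uncastK A : cast (uncast A) = A by rewrite /cast /uncast castmxKV.
  (* [insub 0] finds the only index when the summand is present; otherwise the default 0 is the
     value that an absent component must have. *)
  pose B := if insub 0%N is Some s then uncast (Z (inr (inl s))) else 0.
  pose D := if insub 0%N is Some s then uncast (P *m Z (inr (inr s)) *m P') else 0.
  have ordb (b : bool) (s : 'I_b) : insub 0%N = Some s.
    case: insubP => [u _ u0|]; last by rewrite -leqNgt leqn0; case: b s => -[].
    by congr Some; apply: val_inj; rewrite u0 /=; case: b s {u u0} => -[[]].
  have BE s : cast B = Z (inr (inl s)).
    by rewrite /B (ordb _ s) uncastK.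
  have DE s : conj_mx P P' (cast D) = Z (inr (inr s)).
    by rewrite /D (ordb _ s) uncastK conj_mxVK.
  have [s|||x [xA xC xD]] := onto (fun s => uncast (Z (inl s))) B D.
  + apply: (proj2 (is_sl_in_factor nn _ (factor_param_sq K c d s))).
    by rewrite -/cast uncastK; exact: (HZ (inl s)).
  + have [c1|/negPf c0] := boolP c; last first.
      by rewrite /B insubF // lt0b c0.
    have c_gt0 : (0 < c)%N by rewrite lt0b.
    apply/(is_sp_in_factor nn); rewrite -/cast (BE (Ordinal c_gt0)).
    exact: HZ (inr (inl _)).
  + have [d1|/negPf d0] := boolP d; last first.
      by rewrite /D insubF // lt0b d0.
    have d_gt0 : (0 < d)%N by rewrite lt0b.
    apply/(is_so_in_factor nn _ PP' PTP); rewrite -/cast (DE (Ordinal d_gt0)).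
    exact: HZ (inr (inr _)).
  by exists x => -[s|[s|s]] /=; rewrite ?xA ?xC ?xD ?uncastK.
- move=> x [s|[s|s]] /=; have [xA xC xD] := sub x.
  + exact: (proj1 (is_sl_in_factor nn _ (factor_param_sq K c d s)) (xA s)).
  + have c1 : c by rewrite -(lt0b c); apply: leq_ltn_trans (ltn_ord s).
    by move: xC; rewrite c1 => /(is_sp_in_factor nn).
  + have d1 : d by rewrite -(lt0b d); apply: leq_ltn_trans (ltn_ord s).
    by move: xD; rewrite d1 => /(is_so_in_factor nn _ PP' PTP).
Qed.

Theorem theorem3p1 (R : realType) (n : nat) (Hn : (3 <= n)%N)
    (a : nat) (c d : bool) (L : lie_algebra R[i]) (HL : lie_type_M n a c d L)
    (G : lie_algebra R[i]) (e f h : 'I_n -> G) (HG : is_gim e f h) :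
  exists I : G -> Prop, lie_ideal I /\ lie_quotient_iso I L.
Proof.
case: n Hn HL e f h HG => [//|n] n2 [_ HL] e f h HG.
exact: (gim_quotient n2 HL HG).
Qed.
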